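(* Let $(\Omega_{\mathbb{D}},\Sigma_{\mathbb{D}},\mu_{\mathbb{D}})$ be a $\mathbb{D}$-finite measure space, $\varphi_{\mathbb{D}}:\mathbb{D}^+\to\mathbb{D}^+$ a $\mathbb{D}$-valued Young function, and $\mathcal{L}_{\mathbb{D}}^{\varphi_{\mathbb{D}}}(\Omega_{\mathbb{D}},\Sigma_{\mathbb{D}},\mu_{\mathbb{D}})$ the $\mathbb{BC}$-Orlicz space with the $\mathbb{D}$-Luxemburg norm $\|\cdot\|_{\mathbb{D}}^{\varphi_{\mathbb{D}}}$. Then for $f\in\mathcal{L}_{\mathbb{D}}^{\varphi_{\mathbb{D}}}(\Omega_{\mathbb{D}},\Sigma_{\mathbb{D}},\mu_{\mathbb{D}})$, $$\|f\|_{\mathbb{D}}^{\varphi_{\mathbb{D}}}\le'1\quad\text{if and only if}\quad I_{\varphi_{\mathbb{D}}}^{\mathbb{D}}(f)\le'1 .$$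
   Context: $\mathbb{BC}=\{z_1+jz_2:z_1,z_2\in\mathbb{C}(i)\}$ with $i^2=j^2=-1$, $ij=ji$, is the ring of bicomplex numbers; $k=ij$, $k^2=1$, $e_1=\frac12(1+k)$, $e_2=\frac12(1-k)$; every $Z\in\mathbb{BC}$ is uniquely $Z=w_1e_1+w_2e_2$ with $w_1,w_2\in\mathbb{C}(i)$ and $|Z|_k:=|w_1|e_1+|w_2|e_2$. The hyperbolic numbers are $\mathbb{D}=\{\alpha e_1+\beta e_2:\alpha,\beta\in\mathbb{R}\}\subset\mathbb{BC}$; $\mathbb{D}^+$ are those with $\alpha,\beta\ge0$; $\le'$ is the componentwise order, $\alpha>'0$ means both components positive, and $x<'\infty$ means both components finite; $1=e_1+e_2$. Infima and suprema in $\mathbb{D}$ are componentwise. A $\mathbb{D}$-finite measure is a countably additive set function $\mu_{\mathbb{D}}=\mu_{\mathbb{D}}^1e_1+\mu_{\mathbb{D}}^2e_2:\Sigma_{\mathbb{D}}\to\mathbb{D}^+$ on a $\sigma$-algebra, i.e. $\mu_{\mathbb{D}}^1,\mu_{\mathbb{D}}^2$ are finite positive measures. A function $f=f_1e_1+f_2e_2:\Omega_{\mathbb{D}}\to\mathbb{BC}$ is $\Sigma_{\mathbb{D}}$-measurable when its complex components $f_1,f_2$ are. For measurable $F=F_1e_1+F_2e_2\ge'0$, $\int F\,d\mu_{\mathbb{D}}=\left(\int F_1d\mu_{\mathbb{D}}^1\right)e_1+\left(\int F_2d\mu_{\mathbb{D}}^2\right)e_2$. A Young function $\varphi_{\mathbb{D}}$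 is $\mathbb{D}$-convex ($\varphi_{\mathbb{D}}(\alpha x+(1-\alpha)y)\le'\alpha\varphi_{\mathbb{D}}(x)+(1-\alpha)\varphi_{\mathbb{D}}(y)$ for $0\le'\alpha\le'1$, $\alpha\in\mathbb{D}$), $\varphi_{\mathbb{D}}(0)=0$, and $\varphi_{\mathbb{D}}(x)\to+\infty$ as $x\to\infty$ along every line (ray) in $\mathbb{D}^+$, where ''$+\infty$'' means that at least one idempotent component is infinite. It decomposes as $\varphi_{\mathbb{D}}(x)=\varphi_{\mathbb{D}_1}(e_1x)e_1+\varphi_{\mathbb{D}_2}(e_2x)e_2$. $\mathcal{L}_{\mathbb{D}}^{\varphi_{\mathbb{D}}}$ is the set of measurable $f:\Omega_{\mathbb{D}}\to\mathbb{BC}$ with $\int\varphi_{\mathbb{D}}(|\alpha f|_k)\,d\mu_{\mathbb{D}}<'\infty$ for some $\alpha\in\mathbb{D}$, $\alpha>'0$. The modular is $I_{\varphi_{\mathbb{D}}}^{\mathbb{D}}(f)=\int_{\Omega_{\mathbb{D}}}\varphi_{\mathbb{D}}(|f|_k)\,d\mu_{\mathbb{D}}$, and the $\mathbb{D}$-Luxemburg norm is $\|f\|_{\mathbb{D}}^{\varphi_{\mathbb{D}}}=\inf\{\alpha>'0:I_{\varphi_{\mathbb{D}}}^{\mathbb{D}}(|f|_k/\alpha)\le'1\}$. *)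

(* Defs.v *)
From HB Require Import structures.
From mathcomp Require Import all_boot all_order all_algebra.
From mathcomp Require Import all_classical all_reals all_analysis.
From mathcomp Require Import complex.
From mathcomp Require Import ring lra.

Set Implicit Arguments.
Unset Strict Implicit.
Unset Printing Implicit Defensive.

Import Order.TTheory GRing.Theory Num.Theory.
Import numFieldNormedType.Exports.

Local Open Scope classical_set_scope.
Local Open Scope ring_scope.
Local Open Scope complex_scope.

(* The pair (z1, z2) stands for z1 + j z2; the additive structure is the one of
   the product, the multiplication is given by j^2 = -1. *)
Definition bicomplex (R : rcfType) : Type := (R[i] * R[i])%type.

Section BicomplexRing.
Variable R : rcfType.
Implicit Types Z W : bicomplex R.

HB.instance Definition _ := GRing.Zmodule.on (bicomplex R).

Definition bc_one : bicomplex R := (1, 0).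
Definition bc_mul Z W : bicomplex R :=
  (Z.1 * W.1 - Z.2 * W.2, Z.1 * W.2 + Z.2 * W.1).

Lemma bc_mulA : associative bc_mul.
Proof. by move=> Z W V; congr pair => /=; ring. Qed.

Lemma bc_mulC : commutative bc_mul.
Proof. by move=> Z W; congr pair => /=; ring. Qed.

Lemma bc_mul1 : left_id bc_one bc_mul.
Proof. by case=> z w; congr pair => /=; ring. Qed.

Lemma bc_mulDl : left_distributive bc_mul +%R.
Proof. by move=> Z W V; congr pair => /=; ring. Qed.

Lemma bc_one_neq0 : bc_one != 0.
Proof. by apply/eqP => -[/eqP]; rewrite oner_eq0. Qed.

HB.instance Definition _ := GRing.Zmodule_isComNzRing.Build (bicomplex R)
  bc_mulA bc_mulC bc_mul1 bc_mulDl bc_one_neq0.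

Lemma bc_mulE Z W :
  Z * W = (Z.1 * W.1 - Z.2 * W.2, Z.1 * W.2 + Z.2 * W.1) :> bicomplex R.
Proof. by []. Qed.

Lemma bc_addE Z W : Z + W = (Z.1 + W.1, Z.2 + W.2) :> bicomplex R.
Proof. by []. Qed.

Lemma bc_oppE Z : - Z = (- Z.1, - Z.2) :> bicomplex R.
Proof. by []. Qed.

Lemma bc_1E : 1 = (1, 0) :> bicomplex R.
Proof. by []. Qed.

End BicomplexRing.

Section Bicomplex.
Variable R : rcfType.
Implicit Types Z : bicomplex R.

Definition bc_of_complex (z : R[i]) : bicomplex R := (z, 0).
Definition bc_i : bicomplex R := bc_of_complex 'i%C.
Definition bc_j : bicomplex R := (0, 1).
Definition bc_k : bicomplex R := bc_i * bc_j.
Definition bc_e1 : bicomplex R := bc_of_complex 2^-1 * (1 + bc_k).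
Definition bc_e2 : bicomplex R := bc_of_complex 2^-1 * (1 - bc_k).

(* Solving Z = w1 e1 + w2 e2 for Z = z1 + j z2 gives w1 = z1 - i z2 and
   w2 = z1 + i z2; see bc_idemE and bc_idem_uniq. *)
Definition bc_w1 Z : R[i] := Z.1 - 'i%C * Z.2.
Definition bc_w2 Z : R[i] := Z.1 + 'i%C * Z.2.

Let sqr_i : 'i%C * 'i%C = -1 :> R[i].
Proof. by rewrite -expr2 sqr_i. Qed.

Lemma bc_e1E : bc_e1 = (2^-1, 2^-1 * 'i%C).
Proof.
by rewrite /bc_e1 /bc_k !(bc_mulE, bc_addE, bc_1E) /=; congr pair; ring.
Qed.

Lemma bc_e2E : bc_e2 = (2^-1, - (2^-1 * 'i%C)).
Proof.
by rewrite /bc_e2 /bc_k !(bc_mulE, bc_addE, bc_oppE, bc_1E) /=; congr pair; ring.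
Qed.

Lemma bc_lincombE (u v : R[i]) :
  bc_of_complex u * bc_e1 + bc_of_complex v * bc_e2 =
  (2^-1 * (u + v), 2^-1 * 'i%C * (u - v)).
Proof.
by rewrite bc_e1E bc_e2E bc_addE !bc_mulE /=; congr pair; ring.
Qed.

Lemma bc_idemE Z :
  Z = bc_of_complex (bc_w1 Z) * bc_e1 + bc_of_complex (bc_w2 Z) * bc_e2.
Proof.
case: Z => z w; rewrite bc_lincombE /bc_w1 /bc_w2 /=; congr pair.
  by field.
rewrite [RHS](_ : _ = - ('i%C * 'i%C) * w); last by field.
by rewrite sqr_i; ring.
Qed.

Lemma bc_idem_uniq (u v : R[i]) :
  let Z := bc_of_complex u * bc_e1 + bc_of_complex v * bc_e2 in
  bc_w1 Z = u /\ bc_w2 Z = v.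
Proof.
rewrite /= bc_lincombE /bc_w1 /bc_w2 /=; split.
- rewrite [LHS](_ : _ = 2^-1 * (u + v) - ('i%C * 'i%C) * 2^-1 * (u - v)); last by ring.
  by rewrite sqr_i; field.
- rewrite [LHS](_ : _ = 2^-1 * (u + v) + ('i%C * 'i%C) * 2^-1 * (u - v)); last by ring.
  by rewrite sqr_i; field.
Qed.

End Bicomplex.

(* The pair (a, b) stands for a e1 + b e2.  As e1, e2 are orthogonal idempotents
   with e1 + e2 = 1, the product ring structure of R * R is the right one:
   see the ring morphism bc_of_hyp below. *)
Notation hyperbolic R := (R * R)%type.

Definition bc_of_hyp (R : rcfType) (x : hyperbolic R) : bicomplex R :=
  bc_of_complex x.1%:C * bc_e1 R + bc_of_complex x.2%:C * bc_e2 R.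

Section HyperbolicEmbedding.
Variable R : rcfType.

Lemma bc_of_hyp_inj : injective (@bc_of_hyp R).
Proof.
move=> [a b] [c d] /= E.
have [] := bc_idem_uniq a%:C b%:C; have [] := bc_idem_uniq c%:C d%:C.
by rewrite /bc_of_hyp /= in E; rewrite /= E => -> -> [->] [->].
Qed.

Lemma bc_of_hypB : {morph @bc_of_hyp R : x y / x - y}.
Proof.
move=> x y; rewrite /bc_of_hyp !bc_lincombE /= !rmorphB /=.
by rewrite bc_oppE bc_addE /=; congr pair; ring.
Qed.

Lemma bc_of_hyp1 : bc_of_hyp (1 : hyperbolic R) = 1.
Proof.
rewrite /bc_of_hyp bc_lincombE bc_1E /=.
by congr pair; rewrite ?subrr ?mulr0 //; field.
Qed.

Lemma bc_of_hypM : {morph @bc_of_hyp R : x y / x * y}.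
Proof.
move=> x y; rewrite /bc_of_hyp !bc_lincombE /= !rmorphM /=.
rewrite bc_mulE /=; congr pair; last by field.
set i : R[i] := 'i%C.
rewrite [RHS](_ : _ = 2^-1 * 2^-1 * ((x.1%:C + x.2%:C) * (y.1%:C + y.2%:C)
  - (i * i) * ((x.1%:C - x.2%:C) * (y.1%:C - y.2%:C)))); last by ring.
by rewrite -[i * i]expr2 /i sqr_i; field.
Qed.

HB.instance Definition _ := GRing.isZmodMorphism.Build _ _ (@bc_of_hyp R)
  bc_of_hypB.
HB.instance Definition _ := GRing.isMonoidMorphism.Build _ _ (@bc_of_hyp R)
  (conj bc_of_hyp1 bc_of_hypM).

End HyperbolicEmbedding.

(* Componentwise relations, used on hyperbolic R and on pairs of extended
   reals.  The strict one asks for both components to be strictly smaller. *)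
Definition dle disp (T : porderType disp) (x y : T * T) : bool :=
  ((x.1 <= y.1) && (x.2 <= y.2))%O.
Definition dlt disp (T : porderType disp) (x y : T * T) : bool :=
  ((x.1 < y.1) && (x.2 < y.2))%O.

Notation "x <=' y" := (dle x y) (at level 70, y at next level) : ring_scope.
Notation "x <' y" := (dlt x y) (at level 70, y at next level) : ring_scope.

Definition dinf (R : realType) (A : set (hyperbolic R)) : hyperbolic R :=
  (inf (fst @` A), inf (snd @` A)).

(* |Z|_k; Normc.normc is the real-valued modulus on R[i]. *)
Definition knorm (R : rcfType) (Z : bicomplex R) : hyperbolic R :=
  (Normc.normc (bc_w1 Z), Normc.normc (bc_w2 Z)).

Definition complex_measurable d (T : measurableType d) (R : realType)
    (g : T -> R[i]) : Prop :=
  measurable_fun setT (fun x => complex.Re (g x)) /\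
  measurable_fun setT (fun x => complex.Im (g x)).

Definition bc_measurable d (T : measurableType d) (R : realType)
    (f : T -> bicomplex R) : Prop :=
  complex_measurable (fun x => bc_w1 (f x)) /\
  complex_measurable (fun x => bc_w2 (f x)).

Record dfinite_measure d (T : measurableType d) (R : realType) := DFiniteMeasure {
  dmu1 : {finite_measure set T -> \bar R} ;
  dmu2 : {finite_measure set T -> \bar R} }.

(* Extended values are needed since the components of the integral of a
   nonnegative function may be infinite. *)
Definition dintegral d (T : measurableType d) (R : realType)
    (mu : dfinite_measure T R) (F : T -> hyperbolic R) : \bar R * \bar R :=
  ((\int[dmu1 mu]_x ((F x).1)%:E)%E, (\int[dmu2 mu]_x ((F x).2)%:E)%E).

(* phi is only meaningful on D^+, so every condition is restricted to D^+.
   In young_pinfty, a ray of D^+ is {p + t v : t >= 0} with p, v in D^+ and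
   v <> 0; the value +oo means that at least one component is infinite. *)
Record young_function (R : realType) (phi : hyperbolic R -> hyperbolic R) :
    Prop := YoungFunction {
  young_ge0 : forall x : hyperbolic R, 0 <=' x -> 0 <=' phi x ;
  young_convex : forall a x y : hyperbolic R,
    0 <=' a -> a <=' 1 -> 0 <=' x -> 0 <=' y ->
    phi (a * x + (1 - a) * y) <=' a * phi x + (1 - a) * phi y ;
  young_0 : phi 0 = 0 ;
  young_pinfty : forall p v : hyperbolic R, 0 <=' p -> 0 <=' v -> v <> 0 ->
    (phi (p + (t, t) * v)).1 @[t --> +oo] --> +oo \/
    (phi (p + (t, t) * v)).2 @[t --> +oo] --> +oo }.

(* The idempotent decomposition is a consequence of D-convexity. *)
Lemma young_decomp (R : realType) (phi : hyperbolic R -> hyperbolic R) :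
  young_function phi -> forall x : hyperbolic R, 0 <=' x ->
  phi x = ((phi (x.1, 0)).1, (phi (0, x.2)).2).
Proof.
move=> [_ cvx _ _] [a b] /andP[/= a0 b0].
have pos (u v : R) : 0 <= u -> 0 <= v -> (0 : hyperbolic R) <=' (u, v).
  by move=> u0 v0; apply/andP.
have E1 (u v w : R) : 0 <= u -> 0 <= v -> 0 <= w -> (phi (u, v)).1 <= (phi (u, w)).1.
  move=> u0 v0 w0.
  have e1le : ((1, 0) : hyperbolic R) <=' 1 by rewrite /dle /= lexx ler01.
  have := cvx _ _ _ (pos _ _ ler01 (lexx _)) e1le (pos _ _ u0 w0) (pos _ _ u0 v0).
  rewrite (_ : _ * _ + _ = (u, v)) => [/andP[+ _] /=|]; first by rewrite /= mul1r subrr mul0r addr0.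
  by congr pair => /=; ring.
have E2 (u v w : R) : 0 <= u -> 0 <= v -> 0 <= w -> (phi (v, u)).2 <= (phi (w, u)).2.
  move=> u0 v0 w0.
  have e2le : ((0, 1) : hyperbolic R) <=' 1 by rewrite /dle /= lexx ler01.
  have := cvx _ _ _ (pos _ _ (lexx _) ler01) e2le (pos _ _ w0 u0) (pos _ _ v0 u0).
  rewrite (_ : _ * _ + _ = (v, u)) => [/andP[_ +] /=|]; first by rewrite /= mul1r subrr mul0r addr0.
  by congr pair => /=; ring.
rewrite [LHS]surjective_pairing /=.
by congr pair; apply/le_anti; rewrite ?E1 ?E2.
Qed.

Section Orlicz.
Context d (T : measurableType d) (R : realType).
Variables (mu : dfinite_measure T R) (phi : hyperbolic R -> hyperbolic R).
Implicit Types f : T -> bicomplex R.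

Definition modular f : \bar R * \bar R :=
  dintegral mu (fun x => phi (knorm (f x))).

Definition orlicz_space : set (T -> bicomplex R) :=
  [set f | bc_measurable f /\ exists a : hyperbolic R, 0 <' a /\
     modular (fun x => bc_of_hyp a * f x) <' (+oo%E, +oo%E)].

(* The division is the one of the product ring, where 0 <' a makes a a unit. *)
Definition luxemburg_norm f : hyperbolic R :=
  dinf [set a : hyperbolic R | 0 <' a /\
    modular (fun x => bc_of_hyp (knorm (f x) / a)) <=' (1%E, 1%E)].

End Orlicz.

(* Main.v *)
(* D-convexity decouples the idempotent components, so that everything reduces
   to a real convex function psi >= 0 with psi 0 = 0.  If the norm of g is at
   most 1, then the modular of t g is at most 1 for every t < 1; since psi is
   nondecreasing and left continuous, monotone convergence as t -> 1 bounds the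
   modular of g.  Conversely, if the modular of g is at most 1, then 1 belongs to
   the set whose infimum is the norm. *)
Require Import Defs.
From mathcomp Require Import all_boot all_order all_algebra.
From mathcomp Require Import all_classical all_reals all_analysis.
From mathcomp Require Import measurable_realfun complex.
From mathcomp Require Import ring lra.
Import Order.TTheory GRing.Theory Num.Theory.
Import numFieldNormedType.Exports.

Local Open Scope classical_set_scope.
Local Open Scope ring_scope.

(** * Multiplicativity of the idempotent components and of [knorm] *)

(** [bc_w1] substitutes -i for j, which respects products since (-i)^2 = j^2; [bc_w2] substitutes
    i. *)
Lemma bc_w1M {R : rcfType} (Z W : bicomplex R) :
  bc_w1 (Z * W) = bc_w1 Z * bc_w1 W.
Proof.
rewrite /bc_w1 bc_mulE /=; set i := 'i%C.
have i2 : i * i = -1 by rewrite -expr2 sqr_i.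
rewrite [RHS](_ : _ = Z.1 * W.1 + (i * i) * (Z.2 * W.2) - i * (Z.1 * W.2 + Z.2 * W.1)).
  by rewrite i2; ring.
by ring.
Qed.

Lemma bc_w2M {R : rcfType} (Z W : bicomplex R) :
  bc_w2 (Z * W) = bc_w2 Z * bc_w2 W.
Proof.
rewrite /bc_w2 bc_mulE /=; set i := 'i%C.
have i2 : i * i = -1 by rewrite -expr2 sqr_i.
rewrite [RHS](_ : _ = Z.1 * W.1 + (i * i) * (Z.2 * W.2) + i * (Z.1 * W.2 + Z.2 * W.1)).
  by rewrite i2; ring.
by ring.
Qed.

Lemma normc_ge0 {R : rcfType} (z : R[i]) : 0 <= Normc.normc z.
Proof. by case: z => a b; exact: sqrtr_ge0. Qed.

Lemma normc_real {R : rcfType} (x : R) : Normc.normc x%:C%C = `|x|.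
Proof. by rewrite /= expr0n /= addr0 sqrtr_sqr. Qed.

Lemma knormM {R : rcfType} (Z W : bicomplex R) :
  knorm (Z * W) = knorm Z * knorm W.
Proof. by rewrite /knorm bc_w1M bc_w2M !Normc.normcM. Qed.

Lemma knorm_bc_of_hyp {R : rcfType} (x : hyperbolic R) :
  knorm (bc_of_hyp x) = (`|x.1|, `|x.2|).
Proof.
rewrite /knorm /bc_of_hyp.
by have [-> ->] := bc_idem_uniq x.1%:C%C x.2%:C%C; rewrite !normc_real.
Qed.

Lemma knorm_ge0 {R : rcfType} (Z : bicomplex R) : 0 <=' knorm Z.
Proof. by rewrite /dle /= !normc_ge0. Qed.

(** The product ring inverts componentwise on units only; positivity of both components makes [a] a
    unit. *)
Lemma hyp_div_pos {R : realType} (x a : hyperbolic R) :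
  0 <' a -> x / a = (x.1 / a.1, x.2 / a.2).
Proof.
case/andP => /= a1 a2; have Ua : a \is a GRing.unit.
  by apply/andP; rewrite !unitfE !gt_eqF.
apply: (mulIr Ua); rewrite mulrVK //.
by case: x a a1 a2 Ua => x y [a b] /= a0 b0 _; congr pair => /=; rewrite mulfVK ?gt_eqF.
Qed.

Lemma complex_measurable_normc {d} {T : measurableType d} {R : realType}
    {g : T -> R[i]} :
  complex_measurable g -> measurable_fun setT (fun x => Normc.normc (g x)).
Proof.
case=> mRe mIm.
rewrite (_ : (fun _ => _) =
  Num.sqrt \o (fun x => complex.Re (g x) ^+ 2 + complex.Im (g x) ^+ 2)).
  apply: measurableT_comp; last first.
    by apply: measurable_funD; exact: measurable_funX.
  by apply: nondecreasing_measurable => // x y; exact: ler_wsqrtr.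
by apply/funext => x /=; case: (g x).
Qed.

(** * Convex functions on the nonnegative half-line *)

Record real_young {R : realType} (psi : R -> R) : Prop := RealYoung {
  real_young_ge0 : forall x, 0 <= x -> 0 <= psi x ;
  real_young_convex : forall a x y, 0 <= a -> a <= 1 -> 0 <= x -> 0 <= y ->
    psi (a * x + (1 - a) * y) <= a * psi x + (1 - a) * psi y ;
  real_young_0 : psi 0 = 0 }.
Arguments real_young_ge0 {R psi}.
Arguments real_young_convex {R psi} _ {a x y}.
Arguments real_young_0 {R psi}.

Section RealYoung.
Context {R : realType} {psi : R -> R} (hpsi : real_young psi).
Implicit Types a s t : R.

Lemma real_young_scale {t} {x : R} : 0 <= t -> t <= 1 -> 0 <= x ->
  psi (t * x) <= t * psi x.
Proof.
move=> t0 t1 x0; have := real_young_convex hpsi t0 t1 x0 (lexx 0).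
by rewrite (real_young_0 hpsi) !mulr0 !addr0.
Qed.

(** For y > 0, write x = (x / y) y and scale: psi x <= (x / y) psi y <= psi y. *)
Lemma real_young_homo {x y : R} : 0 <= x -> x <= y -> psi x <= psi y.
Proof.
move=> x0 xy; have y0 := le_trans x0 xy.
have [y_eq0|y_neq0] := eqVneq y 0.
  by have -> : x = y by apply/le_anti; rewrite xy y_eq0.
have ypos : 0 < y by rewrite lt_neqAle eq_sym y_neq0.
have t0 : 0 <= x / y by rewrite divr_ge0.
have t1 : x / y <= 1 by rewrite ler_pdivrMr // mul1r.
have := real_young_scale t0 t1 y0; rewrite divfK // => /le_trans; apply.
by rewrite ler_piMl // (real_young_ge0 hpsi).
Qed.

(* x is the convex combination of t x and 2 x with weights 1/(2 - t) and
   (1 - t)/(2 - t): this yields left continuity of psi at x. *)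
Lemma real_young_lower {t} {x : R} : 0 <= t -> t <= 1 -> 0 <= x ->
  (2 - t) * psi x - (1 - t) * psi (2 * x) <= psi (t * x).
Proof.
move=> t0 t1 x0; have s0 : 0 < 2 - t by lra.
have l0 : 0 <= (2 - t)^-1 by rewrite invr_ge0 ltW.
have l1 : (2 - t)^-1 <= 1 by rewrite invf_le1 //; lra.
have x20 : 0 <= 2 * x by lra.
have := real_young_convex hpsi l0 l1 (mulr_ge0 t0 x0) x20.
have -> : (2 - t)^-1 * (t * x) + (1 - (2 - t)^-1) * (2 * x) = x.
  by field; rewrite gt_eqF.
rewrite -(ler_pM2l s0).
have -> : (2 - t) * ((2 - t)^-1 * psi (t * x) + (1 - (2 - t)^-1) * psi (2 * x))
   = psi (t * x) + (1 - t) * psi (2 * x) by field; rewrite gt_eqF.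
by rewrite lerBlDr.
Qed.

(** Squeeze: monotonicity bounds the values above by psi x, and [real_young_lower] at t = 1 - h
    bounds them below by psi x + h (psi x - psi (2 x)). *)
Lemma real_young_left_cvg {x : R} : 0 <= x ->
  psi ((1 - n.+1%:R^-1) * x) @[n --> \oo] --> psi x.
Proof.
move=> x0; have hcvg := @cvg_harmonic R.
have h0 (n : nat) : 0 <= n.+1%:R^-1 :> R by rewrite invr_ge0.
have h1 (n : nat) : n.+1%:R^-1 <= 1 :> R by rewrite invf_le1 // ler1n.
apply: (@squeeze_cvgr _ _ _ _
  (fun n => psi x + n.+1%:R^-1 * (psi x - psi (2 * x))) (cst (psi x))).
- apply: nearW => n; apply/andP; split.
    have h00 := h0 n; have h11 := h1 n; set h : R := n.+1%:R^-1 in h00 h11 *.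
    have t0 : 0 <= 1 - h by lra.
    have t1 : 1 - h <= 1 by lra.
    apply: le_trans (real_young_lower t0 t1 x0).
    by rewrite le_eqVlt; apply/orP; left; apply/eqP; ring.
  apply: real_young_homo; first by rewrite mulr_ge0 // subr_ge0.
  by rewrite ler_piMl // gerBl.
- rewrite -[X in _ --> X]addr0; apply: cvgD; first exact: cvg_cst.
  by rewrite -[X in _ --> X](mul0r (psi x - psi (2 * x))); exact: cvgMr_tmp.
- exact: cvg_cst.
Qed.

(** * Integrals of psi (t g) for a measurable g >= 0 *)

Context {d} {T : measurableType d} {mu : {measure set T -> \bar R}}.
Context {g : T -> R} (mg : measurable_fun setT g) (g0 : forall x, 0 <= g x).

Lemma measurable_real_young t : 0 <= t ->
  measurable_fun setT (fun x => (psi (t * g x))%:E).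
Proof.
move=> t0; apply/measurable_EFinP.
(* Nothing is known of psi on negative reals; truncating its argument at 0 gives a function that is
   nondecreasing on the whole line, hence measurable. *)
rewrite (_ : (fun _ => _) = (psi \o Num.max 0) \o (fun x => t * g x)); last first.
  by apply/funext => x /=; rewrite max_r // mulr_ge0.
apply: measurableT_comp; last exact: measurable_funM.
apply: nondecreasing_measurable => // x y xy /=; apply: real_young_homo.
  by rewrite le_max lexx.
by rewrite ge_max !le_max lexx xy orbT.
Qed.

Let ge0 t (x : T) : 0 <= t -> (0 <= (psi (t * g x))%:E)%E.
Proof. by move=> t0; rewrite lee_fin (real_young_ge0 hpsi) // mulr_ge0. Qed.

Lemma real_modular_homo s t : 0 <= s -> s <= t ->
  (\int[mu]_x (psi (s * g x))%:E <= \int[mu]_x (psi (t * g x))%:E)%E.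
Proof.
move=> s0 st; have t0 := le_trans s0 st.
apply: ge0_le_integral => //; [|exact: measurable_real_young..|].
  by move=> x _; exact: ge0.
move=> x _; rewrite lee_fin; apply: real_young_homo; first exact: mulr_ge0.
exact: ler_wpM2r.
Qed.

(** If I is the finite integral, scaling by t = 1 / (1 + I) brings it down to at most I / (1 + I) <=
    1, so b = 1 / (t a) works. The summand 1 covers I = 0 and ensures t <= 1. *)
Lemma real_modular_finite_le1 {a} : 0 < a ->
  (\int[mu]_x (psi (a * g x))%:E < +oo)%E ->
  exists2 b, 0 < b & (\int[mu]_x (psi (g x / b))%:E <= 1)%E.
Proof.
move=> a0 fin; set I := (\int[mu]_x _)%E in fin.
have I0 : (0 <= I)%E by apply: integral_ge0 => x _; exact/ge0/ltW.
have If : I \is a fin_num by rewrite ge0_fin_numE.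
set t : R := (1 + fine I)^-1.
have fI0 : 0 <= fine I by exact: fine_ge0.
have t0 : 0 < t by rewrite invr_gt0; lra.
have t1 : t <= 1 by rewrite invf_le1; lra.
exists (t * a)^-1; first by rewrite invr_gt0 mulr_gt0.
apply: (@le_trans _ _ (\int[mu]_x (t%:E * (psi (a * g x))%:E))%E).
  apply: ge0_le_integral => //.
  - by move=> x _; rewrite invrK mulrC; apply/ge0/ltW/mulr_gt0.
  - rewrite invrK; under eq_fun do rewrite mulrC.
    by apply/measurable_real_young/ltW/mulr_gt0.
  - by apply: emeasurable_funM => //; exact/measurable_real_young/ltW.
  - move=> x _; rewrite invrK -EFinM lee_fin mulrC -mulrA.
    by rewrite real_young_scale ?mulr_ge0 // ltW.
rewrite ge0_integralZl_EFin //; [|by move=> x _; exact/ge0/ltW| |exact: ltW].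
  rewrite -/I -(fineK If) -EFinM lee_fin /t mulrC ler_pdivrMr; lra.
exact/measurable_real_young/ltW.
Qed.

Lemma real_modular_le1 :
  (forall t, 0 <= t -> t < 1 -> (\int[mu]_x (psi (t * g x))%:E <= 1)%E) ->
  (\int[mu]_x (psi (g x))%:E <= 1)%E.
Proof.
(* This sequence starts at 0 and increases to 1 while staying below 1, so [le1] applies to every
   term. *)
move=> le1; pose t (n : nat) : R := 1 - n.+1%:R^-1.
have t0 n : 0 <= t n by rewrite subr_ge0 invf_le1 // ler1n.
have t1 n : t n < 1 by rewrite ltrBlDr ltrDl invr_gt0.
pose G n x := (psi (t n * g x))%:E.
have Gcvg x : G n x @[n --> \oo] --> (psi (g x))%:E.
  by apply: cvg_EFin; [exact: nearW|exact: real_young_left_cvg].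
rewrite (_ : (\int[mu]_x _)%E = \int[mu]_x limn (G^~ x))%E; last first.
  by apply: eq_integral => x _; apply/esym/cvg_lim.
have GI : (\int[mu]_x G n x)%E @[n --> \oo] --> (\int[mu]_x limn (G^~ x))%E.
  apply: cvg_monotone_convergence => //.
  - by move=> n; exact: measurable_real_young.
  - by move=> n x _; exact: ge0.
  - move=> x _ n m nm; rewrite lee_fin; apply: real_young_homo; first exact: mulr_ge0.
    by apply: ler_wpM2r => //; rewrite lerB // lef_pV2 ?posrE // ler_nat ltnS.
rewrite -(cvg_lim _ GI) //; apply: lime_le; first by apply/cvg_ex; eexists; exact: GI.
by apply: nearW => n; exact: le1.
Qed.

(** For 0 < t < 1, inf A <= 1 < 1 / t yields some a in A below 1 / t, so that t g <= g / a. *)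
Lemma real_modular_inf_le1 {A : set R} :
  A !=set0 -> inf A <= 1 ->
  (forall a, A a -> 0 < a /\ (\int[mu]_x (psi (g x / a))%:E <= 1)%E) ->
  (\int[mu]_x (psi (g x))%:E <= 1)%E.
Proof.
move=> A0 infA hA; apply: real_modular_le1 => t; rewrite le_eqVlt => /predU1P[<- _|t0 t1].
  under eq_integral do rewrite mul0r (real_young_0 hpsi).
  by rewrite integral0 lee_fin ler01.
have [a Aa at1] : exists2 a, A a & a < t^-1.
  by apply: inf_lt => //; apply: le_lt_trans infA _; rewrite invf_gt1.
have [a0 Ia] := hA a Aa; apply: le_trans Ia.
under [leRHS]eq_integral do rewrite mulrC.
apply: real_modular_homo; first exact: ltW.
by rewrite -[t]invrK lef_pV2 ?posrE ?invr_gt0 // ltW.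
Qed.

End RealYoung.

(** * Splitting the modular into two real integrals *)

Section Components.
Context {R : realType} {phi : hyperbolic R -> hyperbolic R}.
Context (hphi : young_function phi).

Lemma real_young_fst : real_young (fun s => (phi (s, 0)).1).
Proof.
split=> [x x0|a x y a0 a1 x0 y0|]; last by rewrite [phi _](young_0 hphi).
  by have /andP[] : 0 <=' phi (x, 0) by apply: (young_ge0 hphi); rewrite /dle /= x0 lexx.
have dle2 (u v w z : R) : u <= v -> w <= z -> (u, w) <=' (v, z).
  by move=> uv wz; apply/andP.
(* The hyperbolic weight is (a, 0); since both points lie on the first axis, so does their
   combination. *)
have /andP[+ _] := young_convex hphi (dle2 _ _ _ _ a0 (lexx 0))
  (dle2 _ _ _ _ a1 ler01) (dle2 _ _ _ _ x0 (lexx 0)) (dle2 _ _ _ _ y0 (lexx 0)).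
rewrite (_ : _ * _ + _ = (a * x + (1 - a) * y, 0)) //.
by congr pair => /=; rewrite !mulr0 addr0.
Qed.

Lemma real_young_snd : real_young (fun s => (phi (0, s)).2).
Proof.
split=> [x x0|a x y a0 a1 x0 y0|]; last by rewrite [phi _](young_0 hphi).
  by have /andP[] : 0 <=' phi (0, x) by apply: (young_ge0 hphi); rewrite /dle /= x0 lexx.
have dle2 (u v w z : R) : u <= v -> w <= z -> (u, w) <=' (v, z).
  by move=> uv wz; apply/andP.
have /andP[_ +] := young_convex hphi (dle2 _ _ _ _ (lexx 0) a0)
  (dle2 _ _ _ _ ler01 a1) (dle2 _ _ _ _ (lexx 0) x0) (dle2 _ _ _ _ (lexx 0) y0).
rewrite (_ : _ * _ + _ = (0, a * x + (1 - a) * y)) //.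
by congr pair => /=; rewrite !mulr0 addr0.
Qed.

Context {d} {T : measurableType d} (mu : dfinite_measure T R).

(** The components decouple here: [young_decomp] applies pointwise because [knorm] takes values in
    D^+. *)
Lemma modularE (f : T -> bicomplex R) :
  modular mu phi f =
  ((\int[dmu1 mu]_x ((phi ((knorm (f x)).1, 0)).1)%:E)%E,
   (\int[dmu2 mu]_x ((phi (0, (knorm (f x)).2)).2)%:E)%E).
Proof.
by congr pair; apply: eq_integral => x _; rewrite (young_decomp hphi) ?knorm_ge0.
Qed.

(** [modular] takes bicomplex functions, so the quotient in the Luxemburg norm is embedded and
    normed again; being in D^+, it is unchanged. *)
Lemma knorm_div (f : T -> bicomplex R) a x : 0 <' a ->
  knorm (bc_of_hyp (knorm (f x) / a)) =
  ((knorm (f x)).1 / a.1, (knorm (f x)).2 / a.2).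
Proof.
move=> a0; rewrite hyp_div_pos // knorm_bc_of_hyp /=; case/andP: a0 => a1 a2.
by rewrite !ger0_norm // divr_ge0 ?normc_ge0 // ltW.
Qed.

Lemma modular_divE (f : T -> bicomplex R) a : 0 <' a ->
  modular mu phi (fun x => bc_of_hyp (knorm (f x) / a)) =
  ((\int[dmu1 mu]_x ((phi ((knorm (f x)).1 / a.1, 0)).1)%:E)%E,
   (\int[dmu2 mu]_x ((phi (0, (knorm (f x)).2 / a.2)).2)%:E)%E).
Proof.
by move=> a0; rewrite modularE; congr pair; apply: eq_integral => x _; rewrite knorm_div.
Qed.

End Components.

(* Guards against the junk value [inf set0 = 0] in the Luxemburg norm. *)
Lemma orlicz_space_le1 (R : realType) (d : measure_display) (T : measurableType d)
    (mu : dfinite_measure T R) (phi : hyperbolic R -> hyperbolic R)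
    (hphi : young_function phi) (f : T -> bicomplex R) :
  orlicz_space mu phi f ->
  exists a, 0 <' a /\
    modular mu phi (fun x => bc_of_hyp (knorm (f x) / a)) <=' (1%E, 1%E).
Proof.
move=> -[[m1 m2] [a [/andP[/= a1 a2]]]].
rewrite (modularE hphi) => /andP[/= fin1 fin2].
(* As [a] has positive components, it equals its own modulus and can be moved inside [knorm]. *)
have {}fin1 : (\int[dmu1 mu]_x ((phi (a.1 * (knorm (f x)).1, 0)).1)%:E < +oo)%E.
  by under eq_integral do
    rewrite -{1}(gtr0_norm a1) -[_ * _]/((`|a.1|, `|a.2|) * knorm _).1 -knorm_bc_of_hyp -knormM.
have {}fin2 : (\int[dmu2 mu]_x ((phi (0, a.2 * (knorm (f x)).2)).2)%:E < +oo)%E.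
  by under eq_integral do
    rewrite -{1}(gtr0_norm a2) -[_ * _]/((`|a.1|, `|a.2|) * knorm _).2 -knorm_bc_of_hyp -knormM.
have [b1 b10 I1] := real_modular_finite_le1 (real_young_fst hphi)
  (complex_measurable_normc m1) (fun x => normc_ge0 _) a1 fin1.
have [b2 b20 I2] := real_modular_finite_le1 (real_young_snd hphi)
  (complex_measurable_normc m2) (fun x => normc_ge0 _) a2 fin2.
(* The two scaling factors are found independently and paired. *)
have b0 : 0 <' (b1, b2) by apply/andP.
by exists (b1, b2); split=> //; rewrite (modular_divE hphi) //; apply/andP.
Qed.

(** * Norm and modular compared, one idempotent component at a time *)

Theorem theorem4p13 (R : realType) (d : measure_display) (T : measurableType d)
    (mu : dfinite_measure T R) (phi : hyperbolic R -> hyperbolic R)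
    (hphi : young_function phi)
    (f : T -> bicomplex R) (hf : f \in orlicz_space mu phi) :
  luxemburg_norm mu phi f <=' 1 <-> modular mu phi f <=' (1%E, 1%E).
Proof.
move: hf; rewrite inE => hf; have [[m1 m2] _] := hf.
rewrite /luxemburg_norm /dinf; set A := [set a | _].
(* Membership in [A] bounds each component separately, so each projection of [A] meets the
   hypotheses of [real_modular_inf_le1]. *)
have hA a : A a -> [/\ 0 < a.1, 0 < a.2,
    (\int[dmu1 mu]_x ((phi ((knorm (f x)).1 / a.1, 0)).1)%:E <= 1)%E &
    (\int[dmu2 mu]_x ((phi (0, (knorm (f x)).2 / a.2)).2)%:E <= 1)%E].
  move=> [a0]; rewrite (modular_divE hphi) // => /andP[/= I1 I2].
  by case/andP: a0.
split=> [/andP[/= inf1 inf2]|le1].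
  have [a Aa] : A !=set0 by exact: orlicz_space_le1.
  rewrite (modularE hphi); apply/andP; split=> /=.
  - apply: (real_modular_inf_le1 (real_young_fst hphi)
      (complex_measurable_normc m1) (fun x => normc_ge0 _) _ inf1).
      by exists a.1, a.
    by move=> _ [b /hA[? ? ? ?] <-].
  - apply: (real_modular_inf_le1 (real_young_snd hphi)
      (complex_measurable_normc m2) (fun x => normc_ge0 _) _ inf2).
      by exists a.2, a.
    by move=> _ [b /hA[? ? ? ?] <-].
have A1 : A 1.
  have lt01 : (0 : hyperbolic R) <' 1 by rewrite /dlt /= ltr01.
  split=> //; move: le1; congr (is_true (_ <=' _)).
  rewrite (modular_divE hphi) // (modularE hphi).
  by congr pair; apply: eq_integral => x _; rewrite divr1.
(* An infimum is below a member only for sets bounded below; here 0 is a lower bound of both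
   projections. *)
apply/andP; split; apply: ge_inf; [|by exists 1| |by exists 1].
- by exists 0 => _ [b /hA[b1 _ _ _] <-]; exact: ltW.
- by exists 0 => _ [b /hA[_ b2 _ _] <-]; exact: ltW.
Qed.
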